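(* (Entropy Stable 1 (ES1)) With the notation of the context, let $\widehat{\mathbf{R}}$ be the matrix of right eigenvectors of the Powell-modified flux Jacobian $\widehat{\mathbf{A}}$, let $\widehat{\boldsymbol\Lambda}$ be the corresponding diagonal matrix of eigenvalues, and let $\mathbf{H}$ be the entropy Jacobian. If we apply the diagonal scaling matrix $$\mathbf{T}=\mathrm{diag}\left(\frac{c}{c_g\sqrt{2g}},\;\frac{c}{\sqrt{2g}},\;\frac{B_1}{c_g\sqrt{g}},\;\frac{c}{\sqrt{2g}},\;\frac{c}{c_g\sqrt{2g}}\right),\qquad c^2=gh,\quad c_g^2=gh+B_1^2,$$ to the matrix of right eigenvectors $\widehat{\mathbf{R}}$, then, writing $\widetilde{\mathbf{R}}=\widehat{\mathbf{R}}\mathbf{T}$ and $\mathbf{S}=\mathbf{T}^2$, we obtain the Merriam identity $$\mathbf{H}=\widetilde{\mathbf{R}}\widetilde{\mathbf{R}}^T=(\widehat{\mathbf{R}}\mathbf{T})(\widehat{\mathbf{R}}\mathbf{T})^T=\widehat{\mathbf{R}}\mathbf{S}\widehat{\mathbf{R}}^T,$$ which relates the right eigenvectors of $\widehat{\mathbf{A}}$ to the entropy Jacobian matrix. We then have the guaranteed entropy stable flux interface contribution $$\vec{f}^{*,ES1}=\vec{f}^{*,ec}-\frac12\,\mathbf{D}\,\llbracket\vec{u}\rrbracket=\vec{f}^{*,ec}-\frac12\,\widehat{\mathbf{R}}\,|\widehat{\boldsymbol\Lambda}|\,\mathbf{S}\,\widehat{\mathbf{R}}^T\,\llbracket\vec{q}\rrbracket,$$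 where $\mathbf{D}=|\widehat{\mathbf{A}}|=\widehat{\mathbf{R}}|\widehat{\boldsymbol\Lambda}|\widehat{\mathbf{R}}^{-1}$ is the dissipation matrix.
   Context: One-dimensional shallow water magnetohydrodynamics: $h$ is the fluid layer depth, $g$ the constant gravitational acceleration, $(v_1,v_2)$ the velocity and $(B_1,B_2)$ the magnetic field. Conserved variables $\vec{u}=(h,hv_1,hv_2,hB_1,hB_2)^T$, flux $\vec{f}=(hv_1,\;hv_1^2+\frac12 gh^2-hB_1^2,\;hv_1v_2-hB_1B_2,\;0,\;hv_1B_2-hv_2B_1)^T$, source $\vec{s}=-\partial_x(hB_1)(0,0,0,v_1,v_2)^T$, equations $\partial_t\vec{u}+\partial_x\vec{f}=\vec{s}$. Entropy (total energy) $U=\frac12(gh^2+hv_1^2+hv_2^2+hB_1^2+hB_2^2)$; entropy variables $\vec{q}=\partial U/\partial\vec{u}=(gh-\frac12(v_1^2+v_2^2+B_1^2+B_2^2),v_1,v_2,B_1,B_2)^T$; entropy flux $F=gh^2v_1+\frac12(hv_1^3+hv_1v_2^2+hv_1B_2^2-hv_1B_1^2)-hv_2B_1B_2$. The entropy Jacobian is $$\mathbf{H}=\frac{\partial\vec{u}}{\partial\vec{q}}=\frac1g\begin{bmatrix}1&v_1&v_2&B_1&B_2\\ v_1&v_1^2+c^2&v_1v_2&v_1B_1&v_1B_2\\ v_2&v_1v_2&v_2^2+c^2&v_2B_1&v_2B_2\\ B_1&v_1B_1&v_2B_1&B_1^2+c^2&B_1B_2\\ B_2&v_1B_2&v_2B_2&B_1B_2&B_2^2+c^2\end{bmatrix},\qquad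 c^2=gh.$$ The flux Jacobian modified by the Powell source term $-\partial_x(hB_1)(0,B_1,B_2,v_1,v_2)^T$ is $$\widehat{\mathbf{A}}=\begin{bmatrix}0&1&0&0&0\\ gh-v_1^2+B_1^2&2v_1&0&-B_1&0\\ -v_1v_2+B_1B_2&v_2&v_1&0&-B_1\\ 0&0&0&v_1&0\\ v_2B_1-v_1B_2&B_2&-B_1&0&v_1\end{bmatrix}=\widehat{\mathbf{R}}\widehat{\boldsymbol\Lambda}\widehat{\mathbf{R}}^{-1},$$ with $\widehat{\boldsymbol\Lambda}=\mathrm{diag}(v_1-c_g,\,v_1-B_1,\,v_1,\,v_1+B_1,\,v_1+c_g)$, where $c_g^2=gh+B_1^2$ ($c_g$ is the magnetogravity wave speed), and $$\widehat{\mathbf{R}}=\begin{bmatrix}1&0&1&0&1\\ v_1-c_g&0&v_1&0&v_1+c_g\\ v_2&1&v_2&1&v_2\\ 0&0&\frac{c_g^2}{B_1}&0&0\\ B_2&1&B_2&-1&B_2\end{bmatrix}.$$ $|\widehat{\boldsymbol\Lambda}|$ denotes the diagonal matrix of absolute values of the eigenvalues. At an interface between a left cell $L$ and a right cell $R$ of widths $\Delta x_L,\Delta x_R$, write $\llbracket a\rrbracket=a_R-a_L$ and $\{\{a\}\}=\frac12(a_L+a_R)$ (also for products, e.g. $\{\{\Delta xB_1\}\}=\frac12(\Delta x_LB_{1,L}+\Delta x_RB_{1,R})$). The semi-discrete finite volume update at the interface, with numerical flux $\vec{f}^*$, is $$\Delta x_L\,\partial_t\vec{u}_L=\vec{f}_L-\vec{f}^*+\Delta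 x_L\vec{\sigma},\qquad \Delta x_R\,\partial_t\vec{u}_R=\vec{f}^*-\vec{f}_R+\Delta x_R\vec{\sigma},$$ with interface source contribution $$\vec{\sigma}=-\frac12\llbracket hB_1\rrbracket\left(0,0,0,\frac{\{\{v_1B_1\}\}}{\{\{\Delta xB_1\}\}},\frac{\{\{v_2B_2\}\}}{\{\{\Delta xB_2\}\}}\right)^T$$ (if, for example, $B_2=0$, then the corresponding contribution to the entropy balance is also zero). The entropy conserving numerical flux, for which $\vec{f}^*=\vec{f}^{*,ec}$ gives $\partial_t(\Delta x_LU_L+\Delta x_RU_R)+\llbracket F\rrbracket=0$, is $$\vec{f}^{*,ec}=\begin{bmatrix}\{\{h\}\}\{\{v_1\}\}\\ \{\{h\}\}\{\{v_1\}\}^2+\frac12 g\{\{h^2\}\}-\{\{hB_1\}\}\{\{B_1\}\}\\ \{\{h\}\}\{\{v_1\}\}\{\{v_2\}\}-\{\{hB_1\}\}\{\{B_2\}\}\\ \{\{h\}\}\{\{v_1\}\}\{\{B_1\}\}-\{\{hB_1\}\}\{\{v_1\}\}\\ \{\{h\}\}\{\{v_1\}\}\{\{B_2\}\}-\{\{hB_1\}\}\{\{v_2\}\}\end{bmatrix}.$$ A numerical flux is entropy stable at the interface if, when it is used as $\vec{f}^*$ in this update, $\partial_t(\Delta x_LU_L+\Delta x_RU_R)+\llbracket F\rrbracket\le0$. *)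

(* Defs.v *)
From HB Require Import structures.
From mathcomp Require Import all_boot all_order all_algebra.
From mathcomp Require Import all_classical all_reals all_analysis.

Set Implicit Arguments.
Unset Strict Implicit.
Unset Printing Implicit Defensive.

Import Order.TTheory GRing.Theory Num.Theory.
Import numFieldNormedType.Exports.
Local Open Scope ring_scope.

(** One-dimensional shallow water magnetohydrodynamics.
    States are recorded by their primitive variables, so that none of the
    formulas below divides by the depth [h]. *)
Record swmhd_state (R : realType) := SWMHD {
  h : R;
  v1 : R;
  v2 : R;
  B1 : R;
  B2 : R
}.

Definition col5 (R : realType) (s : seq R) : 'cV[R]_5 := \col_(i < 5) s`_i.
Definition row5 (R : realType) (s : seq R) : 'rV[R]_5 := \row_(j < 5) s`_j.
Definition mx5 (R : realType) (rows : seq (seq R)) : 'M[R]_5 :=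
  \matrix_(i < 5, j < 5) (nth [::] rows i)`_j.

Section Continuous.
Variables (R : realType) (g : R).
Implicit Type w : swmhd_state R.

Definition conserved w : 'cV[R]_5 :=
  col5 [:: h w; h w * v1 w; h w * v2 w; h w * B1 w; h w * B2 w].

Definition flux w : 'cV[R]_5 :=
  col5 [:: h w * v1 w;
           h w * v1 w ^+ 2 + 2^-1 * g * h w ^+ 2 - h w * B1 w ^+ 2;
           h w * v1 w * v2 w - h w * B1 w * B2 w;
           0;
           h w * v1 w * B2 w - h w * v2 w * B1 w].

Definition entropy w : R :=
  2^-1 * (g * h w ^+ 2 + h w * v1 w ^+ 2 + h w * v2 w ^+ 2
          + h w * B1 w ^+ 2 + h w * B2 w ^+ 2).

Definition entropy_vars w : 'cV[R]_5 :=
  col5 [:: g * h w - 2^-1 * (v1 w ^+ 2 + v2 w ^+ 2 + B1 w ^+ 2 + B2 w ^+ 2);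
           v1 w; v2 w; B1 w; B2 w].

Definition entropy_flux w : R :=
  g * h w ^+ 2 * v1 w
  + 2^-1 * (h w * v1 w ^+ 3 + h w * v1 w * v2 w ^+ 2
            + h w * v1 w * B2 w ^+ 2 - h w * v1 w * B1 w ^+ 2)
  - h w * v2 w * B1 w * B2 w.

Definition c w : R := Num.sqrt (g * h w).
Definition c_g w : R := Num.sqrt (g * h w + B1 w ^+ 2).

Definition entropy_jacobian w : 'M[R]_5 :=
  g^-1 *: mx5
  [:: [:: 1;    v1 w;                   v2 w;                   B1 w;                   B2 w];
      [:: v1 w; v1 w ^+ 2 + c w ^+ 2;   v1 w * v2 w;            v1 w * B1 w;            v1 w * B2 w];
      [:: v2 w; v1 w * v2 w;            v2 w ^+ 2 + c w ^+ 2;   v2 w * B1 w;            v2 w * B2 w];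
      [:: B1 w; v1 w * B1 w;            v2 w * B1 w;            B1 w ^+ 2 + c w ^+ 2;   B1 w * B2 w];
      [:: B2 w; v1 w * B2 w;            v2 w * B2 w;            B1 w * B2 w;            B2 w ^+ 2 + c w ^+ 2]].

(** The flux Jacobian modified by the Powell source term. *)
Definition Ahat w : 'M[R]_5 :=
  mx5
  [:: [:: 0; 1; 0; 0; 0];
      [:: g * h w - v1 w ^+ 2 + B1 w ^+ 2; 2 * v1 w; 0; - B1 w; 0];
      [:: - (v1 w * v2 w) + B1 w * B2 w; v2 w; v1 w; 0; - B1 w];
      [:: 0; 0; 0; v1 w; 0];
      [:: v2 w * B1 w - v1 w * B2 w; B2 w; - B1 w; 0; v1 w]].

Definition eigenvalues w : 'rV[R]_5 :=
  row5 [:: v1 w - c_g w; v1 w - B1 w; v1 w; v1 w + B1 w; v1 w + c_g w].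

Definition Lambda w : 'M[R]_5 := diag_mx (eigenvalues w).
Definition absLambda w : 'M[R]_5 := diag_mx (map_mx Num.norm (eigenvalues w)).

(** Right eigenvectors, in the order of [eigenvalues]; the third column
    requires [B1 w != 0]. *)
Definition Rhat w : 'M[R]_5 :=
  mx5
  [:: [:: 1;            0; 1;                  0;   1];
      [:: v1 w - c_g w; 0; v1 w;               0;   v1 w + c_g w];
      [:: v2 w;         1; v2 w;               1;   v2 w];
      [:: 0;            0; c_g w ^+ 2 / B1 w;  0;   0];
      [:: B2 w;         1; B2 w;               - 1; B2 w]].

Definition Tscale w : 'M[R]_5 :=
  diag_mx (row5
  [:: c w / (c_g w * Num.sqrt (2 * g));
      c w / Num.sqrt (2 * g);
      B1 w / (c_g w * Num.sqrt g);
      c w / Num.sqrt (2 * g);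
      c w / (c_g w * Num.sqrt (2 * g))]).

Definition Sscale w : 'M[R]_5 := Tscale w *m Tscale w.

(** The dissipation matrix [D = |Ahat|]. *)
Definition dissipation w : 'M[R]_5 := Rhat w *m absLambda w *m invmx (Rhat w).

End Continuous.

Section Interface.
Variables (R : realType) (g : R).
Implicit Types wL wR w : swmhd_state R.

Definition jump (V : zmodType) (a : swmhd_state R -> V) wL wR : V := a wR - a wL.
Definition mean (x y : R) : R := 2^-1 * (x + y).
Definition avg (a : swmhd_state R -> R) wL wR : R := mean (a wL) (a wR).

Definition avg_state wL wR : swmhd_state R :=
  SWMHD (avg (@h R) wL wR) (avg (@v1 R) wL wR) (avg (@v2 R) wL wR)
        (avg (@B1 R) wL wR) (avg (@B2 R) wL wR).

Definition hB1 w : R := h w * B1 w.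

Definition flux_ec wL wR : 'cV[R]_5 :=
  let mh := avg (@h R) wL wR in
  let mh2 := avg (fun w => h w ^+ 2) wL wR in
  let mhB1 := avg hB1 wL wR in
  let mv1 := avg (@v1 R) wL wR in
  let mv2 := avg (@v2 R) wL wR in
  let mB1 := avg (@B1 R) wL wR in
  let mB2 := avg (@B2 R) wL wR in
  col5 [:: mh * mv1;
           mh * mv1 ^+ 2 + 2^-1 * g * mh2 - mhB1 * mB1;
           mh * mv1 * mv2 - mhB1 * mB2;
           mh * mv1 * mB1 - mhB1 * mv1;
           mh * mv1 * mB2 - mhB1 * mv2].

(** ES1 flux in terms of the jump of the conserved variables, with the
    dissipation matrix evaluated at the state [w]. *)
Definition flux_ES1 w wL wR : 'cV[R]_5 :=
  flux_ec wL wR - 2^-1 *: (dissipation g w *m jump (@conserved R) wL wR).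

Definition flux_ES1_entropy w wL wR : 'cV[R]_5 :=
  flux_ec wL wR
  - 2^-1 *: (Rhat g w *m absLambda g w *m Sscale g w *m (Rhat g w)^T
             *m jump (entropy_vars g) wL wR).

(** As [x / 0 = 0], a component [B1] or [B2] of the magnetic field that
    vanishes on both sides contributes nothing to the source. *)
Definition interface_source dxL dxR wL wR : 'cV[R]_5 :=
  - (2^-1 * jump hB1 wL wR) *:
  col5 [:: 0; 0; 0;
           avg (fun w => v1 w * B1 w) wL wR / mean (dxL * B1 wL) (dxR * B1 wR);
           avg (fun w => v2 w * B2 w) wL wR / mean (dxL * B2 wL) (dxR * B2 wR)].

(** The quotients in [interface_source] are genuine, except possibly for a
    component of the magnetic field that is zero in both cells. *)
Definition source_well_defined (dxL dxR : R) wL wR : Prop :=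
  forall B, B = @B1 R \/ B = @B2 R ->
  mean (dxL * B wL) (dxR * B wR) != 0 \/ (B wL = 0 /\ B wR = 0).

(** [WL] and [WR] are the time dependent cell states, which obey at time [t]
    the finite volume update with numerical flux [fstar]. *)
Definition interface_update (dxL dxR : R) (fstar : 'cV[R]_5)
    (WL WR : R -> swmhd_state R) (t : R) : Prop :=
  let uL := fun s => conserved (WL s) in
  let uR := fun s => conserved (WR s) in
  let sigma := interface_source dxL dxR (WL t) (WR t) in
  [/\ derivable uL t 1,
      derivable uR t 1,
      dxL *: 'D_1 uL t = flux g (WL t) - fstar + dxL *: sigma &
      dxR *: 'D_1 uR t = fstar - flux g (WR t) + dxR *: sigma].

Definition entropy_stable (dxL dxR : R) (fstar : 'cV[R]_5) wL wR : Prop :=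
  forall (WL WR : R -> swmhd_state R) (t : R),
  WL t = wL -> WR t = wR ->
  interface_update dxL dxR fstar WL WR t ->
  let E := fun s => dxL * entropy g (WL s) + dxR * entropy g (WR s) in
  derivable E t 1 /\ 'D_1 E t + jump (entropy_flux g) wL wR <= 0.

End Interface.

(* Main.v *)
Require Import Defs.
From HB Require Import structures.
From mathcomp Require Import all_boot all_order all_algebra.
From mathcomp Require Import all_classical all_reals all_analysis.
From mathcomp Require Import ring lra.
Import Order.TTheory GRing.Theory Num.Theory.
Import numFieldNormedType.Exports.
Local Open Scope ring_scope.

(** The columns of [Rhat] are eigenvectors of [Ahat], and they are linearly
    independent when [g h > 0] and [B1 != 0], which gives the diagonalization.
    An eigenvector is determined only up to scale.  [Tscale] is the choice of
    scales for which the rescaled eigenvectors factor the symmetric positive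
    definite matrix [H = du/dq] ([merriam]).  As [T] is diagonal,
    [(R T)(R T)^T = R S R^T].

    This identity turns the dissipation term into a symmetric one.  Write [[a]]
    for a jump across the interface and [{a}] for an arithmetic mean.  At the
    arithmetic mean of the two states the chain rule [du = H dq] holds exactly
    for jumps, because [u] and [q] are at most quadratic in the primitive
    variables and [[ab] = {a}[b] + {b}[a]] ([jump_conserved]).  Hence
      [R |Lambda| R^-1 [u] = R |Lambda| R^-1 (R S R^T) [q] = R |Lambda| S R^T [q]],
    so that the two forms of the flux coincide ([flux_ES1E]).

    For the stability, the gradient of the entropy [U] with respect to [u] is
    [q], so pairing the update of each cell with its [q] gives the time
    derivative of the total entropy.  Two identities evaluate this pairing: the
    entropy conserving flux satisfies Tadmor's jump condition up to a remainder
    proportional to the jump [[h B1]] ([flux_ec_potential]), and the interface source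
    cancels precisely that remainder ([dotp_source]).  What is left, for an
    arbitrary numerical flux [f], is
      [d/dt (dxL U_L + dxR U_R) + [F] = [q] . (f - f_ec)]
    ([entropy_balance]).  For the ES1 flux in entropy variables the right-hand
    side is [- 1/2 [q]^T R |Lambda| S R^T [q]], and [|Lambda| S] is diagonal
    with nonnegative entries, so it is at most [0]. *)

(** * Vectors and matrices of size 5 *)

Lemma sum_ord5 (V : nmodType) (F : 'I_5 -> V) :
  \sum_(i < 5) F i =
  F (inord 0) + F (inord 1) + F (inord 2) + F (inord 3) + F (inord 4).
Proof.
rewrite !big_ord_recl big_ord0 addr0 !addrA.
by do 4?[congr (_ + _)]; congr F; apply/val_inj; rewrite /= inordK.
Qed.

Lemma ord5_ind (P : 'I_5 -> Prop) :
  P (inord 0) -> P (inord 1) -> P (inord 2) -> P (inord 3) -> P (inord 4) ->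
  forall i, P i.
Proof.
move=> P0 P1 P2 P3 P4 i; rewrite -(inord_val i).
by case: i => [[|[|[|[|[|//]]]]] lti].
Qed.

Definition dotp {R : realType} (x y : 'cV[R]_5) : R := (x^T *m y) 0 0.

Lemma dotpE {R : realType} (x y : 'cV[R]_5) :
  dotp x y = \sum_(i < 5) x i 0 * y i 0.
Proof. by rewrite /dotp mxE; apply: eq_bigr => i _; rewrite mxE. Qed.

Lemma dotpDl {R : realType} (x y z : 'cV[R]_5) :
  dotp (x + y) z = dotp x z + dotp y z.
Proof. by rewrite /dotp linearD /= mulmxDl mxE. Qed.

Lemma dotpDr {R : realType} (x y z : 'cV[R]_5) :
  dotp x (y + z) = dotp x y + dotp x z.
Proof. by rewrite /dotp mulmxDr mxE. Qed.

Lemma dotpZl {R : realType} (k : R) (x y : 'cV[R]_5) :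
  dotp (k *: x) y = k * dotp x y.
Proof. by rewrite /dotp linearZ /= -scalemxAl [LHS]mxE. Qed.

Lemma dotpZr {R : realType} (k : R) (x y : 'cV[R]_5) :
  dotp x (k *: y) = k * dotp x y.
Proof. by rewrite /dotp -scalemxAr [LHS]mxE. Qed.

Lemma dotpNl {R : realType} (x y : 'cV[R]_5) : dotp (- x) y = - dotp x y.
Proof. by rewrite -scaleN1r dotpZl mulN1r. Qed.

Lemma dotpNr {R : realType} (x y : 'cV[R]_5) : dotp x (- y) = - dotp x y.
Proof. by rewrite -scaleN1r dotpZr mulN1r. Qed.

(** With [y = A^T x] the value is the weighted sum of squares
    [d_0 y_0^2 + d_1 y_1^2 + ...]. *)
Lemma dotp_diag_ge0 {R : realType} (A : 'M[R]_5) (d : 'rV[R]_5) (x : 'cV[R]_5) :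
  (forall i, 0 <= d 0 i) -> 0 <= dotp x (A *m diag_mx d *m A^T *m x).
Proof.
move=> d_ge0; rewrite /dotp.
have -> : x^T *m (A *m diag_mx d *m A^T *m x)
    = (A^T *m x)^T *m (diag_mx d *m (A^T *m x)).
  by rewrite trmx_mul trmxK !mulmxA.
rewrite mul_diag_mx mxE; apply: sumr_ge0 => i _.
by rewrite !mxE mulrCA -expr2 mulr_ge0 ?sqr_ge0.
Qed.

(** * Eigenstructure of the Powell-modified flux Jacobian *)

Lemma c_sqr {R : realType} (g : R) (w : swmhd_state R) :
  0 <= g * h w -> c g w ^+ 2 = g * h w.
Proof. exact: sqr_sqrtr. Qed.

Lemma c_g_sqr {R : realType} (g : R) (w : swmhd_state R) :
  0 <= g * h w -> c_g g w ^+ 2 = g * h w + B1 w ^+ 2.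
Proof. by move=> gh; rewrite sqr_sqrtr// addr_ge0// sqr_ge0. Qed.

Lemma c_g_gt0 {R : realType} (g : R) (w : swmhd_state R) :
  0 < g * h w -> 0 < c_g g w.
Proof. by move=> gh; rewrite sqrtr_gt0 ltr_wpDr// sqr_ge0. Qed.

Ltac mx_entries := apply/matrixP; do 2 elim/ord5_ind;
  rewrite !mxE ?sum_ord5 !mxE ?inordK//=.

(** The left eigenvectors of [Ahat], normalized against the columns of
    [Rhat]; the fourth row of [Rhat] has a single nonzero entry, which decouples
    the third unknown, and the rest splits into the sums and differences of the
    two waves of each kind. *)
Definition Rhat_inv {R : realType} (g : R) (w : swmhd_state R) : 'M[R]_5 :=
  let cg := c_g g w in
  mx5
  [:: [:: (v1 w + cg) / (2 * cg); - (2 * cg)^-1; 0; - (B1 w / (2 * cg ^+ 2)); 0];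
      [:: - (v2 w + B2 w) / 2; 0; 2^-1; 0; 2^-1];
      [:: 0; 0; 0; B1 w / cg ^+ 2; 0];
      [:: (B2 w - v2 w) / 2; 0; 2^-1; 0; - 2^-1];
      [:: (cg - v1 w) / (2 * cg); (2 * cg)^-1; 0; - (B1 w / (2 * cg ^+ 2)); 0]].

Lemma mulmx_Rhat_inv {R : realType} (g : R) (w : swmhd_state R) :
  0 < g * h w -> B1 w != 0 -> Rhat g w *m Rhat_inv g w = 1%:M.
Proof.
move=> gh B1_neq0; have := lt0r_neq0 (c_g_gt0 _ _ gh) => cg_neq0.
mx_entries; rewrite -?val_eqE /= ?inordK //=; field; rewrite ?B1_neq0 ?cg_neq0 //.
Qed.

Lemma Rhat_unit {R : realType} (g : R) (w : swmhd_state R) :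
  0 < g * h w -> B1 w != 0 -> Rhat g w \in unitmx.
Proof. by move=> gh /(mulmx_Rhat_inv _ _ gh) /mulmx1_unit[]. Qed.

Lemma Ahat_eigen {R : realType} (g : R) (w : swmhd_state R) :
  0 < g * h w -> B1 w != 0 -> Ahat g w *m Rhat g w = Rhat g w *m Lambda g w.
Proof.
move=> gh B1_neq0; have cg2 := c_g_sqr _ _ (ltW gh).
rewrite /Lambda mul_mx_diag; mx_entries; field: cg2 => //.
Qed.

(** * Merriam identity *)

(** The square roots in [Tscale] enter [S] only through their squares, which are
    polynomials in [g] and the state: the Merriam identity is an identity
    between rational functions. *)
Lemma Sscale_diag {R : realType} (g : R) (w : swmhd_state R) :
  0 < g -> 0 < g * h w ->
  Sscale g w = diag_mx (row5
  [:: g * h w / (2 * g * c_g g w ^+ 2);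
      g * h w / (2 * g);
      B1 w ^+ 2 / (g * c_g g w ^+ 2);
      g * h w / (2 * g);
      g * h w / (2 * g * c_g g w ^+ 2)]).
Proof.
move=> g_gt0 gh; rewrite -(c_sqr _ _ (ltW gh)) /Sscale /Tscale mulmx_diag.
have sg : Num.sqrt g ^+ 2 = g by rewrite sqr_sqrtr ?ltW.
have s2g : Num.sqrt (2 * g) ^+ 2 = 2 * g by rewrite sqr_sqrtr ?mulr_ge0 ?ltW.
congr diag_mx; apply/rowP; elim/ord5_ind; rewrite !mxE inordK//= -expr2.
all: by rewrite expr_div_n ?exprMn ?s2g ?sg // [X in _ / X]mulrC.
Qed.

(** The scales can be read off the entries.  For instance the entry [(4,4)]
    (counted from 1) of [R S R^T] is [s_3 (c_g^2 / B1)^2], which forces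
    [s_3 = B1^2 / (g c_g^2)] as [H_44 = c_g^2 / g]. *)
Lemma merriam {R : realType} (g : R) (w : swmhd_state R) :
  0 < g -> 0 < g * h w -> B1 w != 0 ->
  entropy_jacobian g w = Rhat g w *m Sscale g w *m (Rhat g w)^T.
Proof.
move=> g_gt0 gh B1_neq0; have g_neq0 := lt0r_neq0 g_gt0.
have cg_neq0 := lt0r_neq0 (c_g_gt0 _ _ gh).
have cg2 := c_g_sqr _ _ (ltW gh); have c2 := c_sqr _ _ (ltW gh).
rewrite (Sscale_diag _ _ g_gt0 gh) mul_mx_diag.
have cg2_neq0 : g * h w + B1 w ^+ 2 != 0 by rewrite -cg2 expf_neq0.
mx_entries; rewrite ?c2; field: cg2; rewrite ?cg_neq0 ?g_neq0 ?B1_neq0 //.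
Qed.

(** * The two forms of the dissipation term *)

(** The discrete chain rule: [[ab] = {a}[b] + {b}[a]] is an exact product rule
    for jumps, and it is the reason why the mean state has to be the arithmetic
    one. *)
Lemma jump_conserved {R : realType} (g : R) (wL wR : swmhd_state R) :
  0 < g -> 0 <= g * h (avg_state wL wR) ->
  jump (@conserved R) wL wR
    = entropy_jacobian g (avg_state wL wR) *m jump (entropy_vars g) wL wR.
Proof.
move=> g_gt0 gh; have g_neq0 := lt0r_neq0 g_gt0; have := c_sqr _ _ gh.
rewrite /jump /entropy_jacobian; set a := c g _ => c2.
apply/colP; elim/ord5_ind; rewrite !mxE sum_ord5 !mxE !inordK//= ?c2 /=
  /avg /mean; field => //.
Qed.

Lemma flux_ES1E {R : realType} (g : R) (wL wR : swmhd_state R) :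
  let wbar := avg_state wL wR in
  0 < g -> 0 < g * h wbar -> B1 wbar != 0 ->
  flux_ES1 g wbar wL wR = flux_ES1_entropy g wbar wL wR.
Proof.
move=> wbar g_gt0 gh B1_neq0; rewrite /flux_ES1 /flux_ES1_entropy.
rewrite (jump_conserved _ _ _ g_gt0 (ltW gh)) (merriam _ _ g_gt0 gh B1_neq0).
by rewrite /dissipation !mulmxA mulmxKV ?Rhat_unit.
Qed.

(** * Entropy balance at an interface *)

(** Only the conserved variables are known to be differentiable in time, hence
    the entropy is expressed through them.  The formula also holds where the
    depth vanishes, since all of [u] vanishes there and [0^-1 = 0]; it can thus
    be differentiated without restriction to a neighborhood where [h] is
    nonzero. *)
Lemma entropy_conservedE {R : realType} (g : R) (w : swmhd_state R)
    (u := conserved w) :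
  entropy g w = 2^-1 * (g * u (inord 0) 0 ^+ 2
    + (u (inord 0) 0)^-1 * (u (inord 1) 0 ^+ 2 + u (inord 2) 0 ^+ 2
                            + u (inord 3) 0 ^+ 2 + u (inord 4) 0 ^+ 2)).
Proof.
rewrite /u !mxE !inordK//= /entropy.
by have [->|h_neq0] := eqVneq (h w) 0; [rewrite invr0; ring | field].
Qed.

(** The entropy variables are the gradient of the entropy: the chain rule
    applied to [entropy_conservedE]. *)
Lemma is_derive_entropy {R : realType} (g : R) (W : R -> swmhd_state R) (t : R)
    (u := fun s => conserved (W s)) :
  h (W t) != 0 -> derivable u t 1 ->
  is_derive t 1 (fun s => entropy g (W s))
    (dotp (entropy_vars g (W t)) ('D_1 u t)).
Proof.
move=> h_neq0 du.
have {}du i : is_derive t 1 (fun s => u s i 0) ('D_1 u t i 0).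
  rewrite derive_mx// mxE; apply: derivableP.
  by move/derivable_mxP : du; apply.
have h0 : u t (inord 0) 0 = h (W t) by rewrite !mxE inordK.
have dV : is_derive t 1 (fun s => (u s (inord 0) 0)^-1)
    (- (h (W t)) ^- 2 *: 'D_1 u t (inord 0) 0).
  have dh := du (inord 0).
  apply: DeriveDef; first by apply: derivableV; rewrite ?h0.
  by rewrite deriveV ?h0// derive_val.
rewrite (_ : (fun s => _) = 2^-1 \*: (g \*: (fun s => u s (inord 0) 0) ^+ 2
  + (fun s => (u s (inord 0) 0)^-1) * ((fun s => u s (inord 1) 0) ^+ 2
  + (fun s => u s (inord 2) 0) ^+ 2 + (fun s => u s (inord 3) 0) ^+ 2
  + (fun s => u s (inord 4) 0) ^+ 2))); last first.
  by apply/funext => s; rewrite entropy_conservedE.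
apply: is_derive_eq.
rewrite dotpE sum_ord5 !fctE /u !mxE !inordK//= /GRing.scale /=.
by field.
Qed.

(** Tadmor's condition [[q] . f_ec = [q . f - F]], where [q . f - F] is the
    entropy potential, with the remainder due to the failure of the divergence
    constraint [[h B1] = 0].  The potential equals
    [g h^2 v1 / 2 - h B1 (v1 B1 + v2 B2)]; the product rule for jumps applied to
    its last term produces [{h B1} [v1 B1 + v2 B2]], which [f_ec] reproduces,
    and [[h B1] {v1 B1 + v2 B2}], which it does not. *)
Lemma flux_ec_potential {R : realType} (g : R) (wL wR : swmhd_state R) :
  dotp (jump (entropy_vars g) wL wR) (flux_ec g wL wR)
  = jump (fun w => dotp (entropy_vars g w) (flux g w) - entropy_flux g w) wL wR
    + jump (@hB1 R) wL wR * (avg (fun w => v1 w * B1 w) wL wR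
                             + avg (fun w => v2 w * B2 w) wL wR).
Proof.
rewrite /jump !dotpE !sum_ord5 !mxE !inordK//= /avg /mean /entropy_flux /hB1.
by field.
Qed.

(** The denominators of the source are chosen so that the sum
    [dxL B_L + dxR B_R = 2 {dx B}] over the two cells cancels them. *)
Lemma dotp_source {R : realType} (g dxL dxR : R) (wL wR : swmhd_state R) :
  source_well_defined dxL dxR wL wR ->
  dotp (dxL *: entropy_vars g wL + dxR *: entropy_vars g wR)
       (interface_source dxL dxR wL wR)
  = - jump (@hB1 R) wL wR * (avg (fun w => v1 w * B1 w) wL wR
                             + avg (fun w => v2 w * B2 w) wL wR).
Proof.
move=> wd.
have quot (v B : swmhd_state R -> R) : B = @B1 R \/ B = @B2 R ->
    avg (fun w => v w * B w) wL wR / mean (dxL * B wL) (dxR * B wR)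
      * (dxL * B wL + dxR * B wR)
    = 2 * avg (fun w => v w * B w) wL wR.
  (* Where [B] vanishes in both cells the quotient is [0 / 0 = 0], and the
     average of [v B] on the right is [0] as well. *)
  move=> /wd[m_neq0|[BL BR]]; last by rewrite /avg /mean BL BR; ring.
  have -> : dxL * B wL + dxR * B wR = 2 * mean (dxL * B wL) (dxR * B wR).
    by rewrite /mean; field.
  by field.
have q1 := quot (@v1 R) (@B1 R) (or_introl erefl).
have q2 := quot (@v2 R) (@B2 R) (or_intror erefl).
rewrite dotpE sum_ord5 !mxE !inordK//=.
set J := jump _ _ _.
move: q1 q2; set a := _ / _; set b := _ / mean (_ * B2 _) _ => q1 q2.
apply: (@mulfI _ 2) => //.
transitivity (- J * (a * (dxL * B1 wL + dxR * B1 wR)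
                     + b * (dxL * B2 wL + dxR * B2 wR))); first by field.
by rewrite q1 q2; ring.
Qed.

(** Pairing the update of each cell with its entropy variables leaves
    [[q] . fstar - [q . f]] and the contribution of the source; the latter is
    absorbed by [flux_ec_potential], by which [[q . f] - [F]] minus that
    contribution equals [[q] . f_ec]. *)
Lemma entropy_balance {R : realType} (g dxL dxR t : R) (fstar : 'cV[R]_5)
    (WL WR : R -> swmhd_state R) :
  let E := fun s => dxL * entropy g (WL s) + dxR * entropy g (WR s) in
  h (WL t) != 0 -> h (WR t) != 0 ->
  source_well_defined dxL dxR (WL t) (WR t) ->
  interface_update g dxL dxR fstar WL WR t ->
  derivable E t 1 /\
  'D_1 E t + jump (entropy_flux g) (WL t) (WR t)
    = dotp (jump (entropy_vars g) (WL t) (WR t))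
           (fstar - flux_ec g (WL t) (WR t)).
Proof.
move=> E hL hR wd [duL duR eL eR].
have dL := is_derive_entropy g _ _ hL duL.
have dR := is_derive_entropy g _ _ hR duR.
have dE : is_derive t 1 E
  (dxL * dotp (entropy_vars g (WL t)) ('D_1 (fun s => conserved (WL s)) t)
   + dxR * dotp (entropy_vars g (WR t)) ('D_1 (fun s => conserved (WR s)) t)).
  rewrite (_ : E = dxL \*: (fun s => entropy g (WL s))
                   + dxR \*: (fun s => entropy g (WR s)))//.
  by apply: is_deriveD.
split; first exact: ex_derive.
rewrite derive_val.
have := flux_ec_potential g (WL t) (WR t).
have := dotp_source g _ _ _ _ wd.
rewrite /jump -!dotpZr eL eR !(dotpDl, dotpDr, dotpZl, dotpZr, dotpNl, dotpNr).
lra.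
Qed.

(** * Entropy stability *)

(** [|Lambda| S = |Lambda| T^2] is diagonal with entries [|lambda_i| t_i^2]. *)
Lemma ES1_dissipation_ge0 {R : realType} (g : R) (w : swmhd_state R) (x : 'cV[R]_5) :
  0 <= dotp x (Rhat g w *m absLambda g w *m Sscale g w *m (Rhat g w)^T *m x).
Proof.
rewrite /absLambda /Sscale /Tscale !mulmx_diag -[X in X *m _ *m _]mulmxA mulmx_diag.
apply: dotp_diag_ge0 => i; rewrite !mxE -expr2.
by rewrite mulr_ge0 ?sqr_ge0.
Qed.

Lemma flux_ES1_entropy_stable {R : realType} (g dxL dxR : R) (w wL wR : swmhd_state R) :
  h wL != 0 -> h wR != 0 -> source_well_defined dxL dxR wL wR ->
  entropy_stable g dxL dxR (flux_ES1_entropy g w wL wR) wL wR.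
Proof.
move=> hL hR wd WL WR t eL eR upd E; subst wL wR.
have [dE ->] := entropy_balance _ _ _ _ _ _ _ hL hR wd upd.
split=> //; rewrite /flux_ES1_entropy addrAC subrr add0r dotpNr dotpZr.
rewrite oppr_le0 mulr_ge0 ?invr_ge0//.
exact: ES1_dissipation_ge0.
Qed.

Theorem theorem2 (R : realType) (g : R) (g_gt0 : 0 < g) :
  (forall w : swmhd_state R, 0 < h w -> B1 w != 0 ->
    [/\ Rhat g w \in unitmx,
        Ahat g w = Rhat g w *m Lambda g w *m invmx (Rhat g w),
        entropy_jacobian g w
          = (Rhat g w *m Tscale g w) *m (Rhat g w *m Tscale g w)^T &
        (Rhat g w *m Tscale g w) *m (Rhat g w *m Tscale g w)^T
          = Rhat g w *m Sscale g w *m (Rhat g w)^T])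
  /\
  (forall wL wR : swmhd_state R, 0 < h wL -> 0 < h wR ->
    let wbar := avg_state wL wR in
    B1 wbar != 0 ->
    flux_ES1 g wbar wL wR = flux_ES1_entropy g wbar wL wR
    /\ forall dxL dxR : R, 0 < dxL -> 0 < dxR ->
       source_well_defined dxL dxR wL wR ->
       entropy_stable g dxL dxR (flux_ES1 g wbar wL wR) wL wR)
  /\
  (forall (wL wR w : swmhd_state R) (dxL dxR : R),
    0 < h wL -> 0 < h wR -> 0 < h w -> B1 w != 0 ->
    0 < dxL -> 0 < dxR ->
    source_well_defined dxL dxR wL wR ->
    entropy_stable g dxL dxR (flux_ES1_entropy g w wL wR) wL wR).
Proof.
split=> [w h_gt0 B1_neq0|].
  have gh := mulr_gt0 g_gt0 h_gt0; have unitR := Rhat_unit _ _ gh B1_neq0.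
  have TS : (Rhat g w *m Tscale g w) *m (Rhat g w *m Tscale g w)^T
          = Rhat g w *m Sscale g w *m (Rhat g w)^T.
    by rewrite trmx_mul /Tscale tr_diag_mx /Sscale !mulmxA.
  split=> //; last by rewrite TS merriam.
  by rewrite -Ahat_eigen// mulmxK.
split=> [wL wR hL hR wbar B1_neq0|wL wR w dxL dxR hL hR _ _ _ _ wd].
  have gh : 0 < g * h wbar by rewrite mulr_gt0//= /avg /mean mulr_gt0 ?addr_gt0.
  have fE := flux_ES1E _ _ _ g_gt0 gh B1_neq0.
  split=> // dxL dxR _ _ wd; rewrite fE.
  by apply: flux_ES1_entropy_stable => //; exact: lt0r_neq0.
by apply: flux_ES1_entropy_stable => //; exact: lt0r_neq0.
Qed.
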